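(* Let $A$ be a Banach algebra and suppose that $D:A\to A^*$ is a surjective derivation. If $D'':A^{**}\to A^{***}$ is a derivation, then the following assertions hold. (1) $A^*$ has the $w^*wc$-property and $A^{**}$ has the $Lw^*wc$-property with respect to $A$. (2) For every $a''\in A^{**}$, the mapping $x''\mapsto a''x''$ from $A^{**}$ into $A^{**}$ is weak$^*$-to-weak continuous. (3) $A$ is Arens regular. (4) If $A$ has a bounded left approximate identity, then $A$ is reflexive.
   Context: A derivation from a Banach algebra $C$ into a Banach $C$-bimodule $E$ is a bounded linear map with $D(xy)=xD(y)+D(x)y$. $D''$ is the second adjoint of $D$. $A^{**}$ carries the first Arens product $a''b''=w^*\text{-}\lim_\alpha w^*\text{-}\lim_\beta a_\alpha b_\beta$ (bounded nets in $A$, $a_\alpha\to a''$, $b_\beta\to b''$ weak$^*$), and $A^{***}$ is the dual $A^{**}$-bimodule of $A^{**}$: $\langle a'''a'',x''\rangle=\langle a''',a''x''\rangle$, $\langle a''a''',x''\rangle=\langle a''',x''a''\rangle$. $A$ is Arens regular if the first Arens product coincides with the second, $a''\circ b''=w^*\text{-}\lim_\beta w^*\text{-}\lim_\alpha a_\alpha b_\beta$. For a Banach $A$-bimodule $B$, its dual is a Banach $A$-bimodule via $\langle b'a,b\rangle=\langle b',ab\rangle$, $\langle ab',b\rangle=\langle b',ba\rangle$. An element $b'\in B^*$ has the $Lw^*wc$-property with respect to $A$ if for every bounded net $(a_\alpha)_\alpha\subseteq A$, $b'a_\alpha\to 0$ weak$^*$ implies $b'a_\alpha\to 0$ weakly.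 It has the $Rw^*wc$-property if the same holds with $a_\alpha b'$ in place of $b'a_\alpha$, and the $w^*wc$-property if it has both. $B^*$ has one of these properties with respect to $A$ if each of its elements has it. This is applied to $A^*$ (with $B=A$) and $A^{**}$ (with $B=A^*$). *)

(* Defs.v *)
From HB Require Import structures.
From mathcomp Require Import all_boot all_order all_algebra.
From mathcomp Require Import complex.
From mathcomp Require Import all_classical reals topology normedtype.
Set Implicit Arguments.
Unset Strict Implicit.
Unset Printing Implicit Defensive.
Import Order.TTheory GRing.Theory Num.Theory.
Import numFieldNormedType.Exports.
Local Open Scope classical_set_scope.
Local Open Scope ring_scope.

(* Banach spaces are taken over either of the two classical scalar fields. *)
Variant scalars := Reals | Complexes.

Definition scalar_field (R : realType) (s : scalars) : numFieldType :=
  match s with Reals => R | Complexes => complex R end.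

Lemma scalar_inf (R : realType) (s : scalars) (S : set (scalar_field R s)) :
  S !=set0 -> (forall c, S c -> 0 <= c) ->
  exists m, (forall c, S c -> m <= c) /\
    (forall d, 0 <= d -> (forall c, S c -> d <= c) -> d <= m).
Proof.
case: s S => /= S [c0 Sc0] S0.
  have hS : has_inf S by split; [exists c0|exists 0 => c /S0].
  exists (inf S); split=> [c Sc|d _ dS]; first exact: (ge_inf hS.2).
  by apply: lb_le_inf; [exists c0|move=> c /dS].
have reE c : S c -> c = (complex.Re c)%:C%C.
  move=> /S0; rewrite lecE => /andP[/eqP/= e _].
  by case: c e => a b /= ->.
pose T := [set complex.Re c | c in S].
have T0 : T !=set0 by exists (complex.Re c0); exists c0.
have hT : has_inf T.
  split => //; exists 0 => _ [c Sc <-].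
  by move: (S0 c Sc); rewrite lecE => /andP[].
exists (inf T)%:C%C; split=> [c Sc|d d0 dS].
  by rewrite (reE c Sc) lecR; apply: (ge_inf hT.2); exists c.
have dE : d = (complex.Re d)%:C%C.
  by move: d0; rewrite lecE => /andP[/eqP/= e _]; case: d e {dS} => a b /= ->.
rewrite dE lecR; apply: lb_le_inf => // _ [c Sc <-].
by move: (dS c Sc); rewrite {1}dE {1}(reE c Sc) lecR.
Qed.

Lemma complex_complete (R : realType) (F : set_system ((complex R)^o)) :
  ProperFilter F -> cauchy F -> cvg F.
Proof.
move=> FF /cauchy_ballP Fc.
have cv (p : complex R -> R) : (forall x y, p (x - y) = p x - p y) ->
    (forall x : complex R, `|p x|%:C%C <= `|x|) -> cvg (p @ F).
  move=> pB ple; apply: R_complete.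
  apply/cauchy_ballP => e e0.
  have /(Fc _) : (0 : complex R) < e%:C%C by rewrite ltcR.
  rewrite !near_simpl => h; rewrite near_map2.
  apply: filterS h => -[x y] /=; rewrite -!ball_normE /=.
  move=> xy; rewrite -pB -ltcR; exact: le_lt_trans xy.
have reb (x : complex R) : `|complex.Re x|%:C%C <= `|x|.
  rewrite normc_def lecR -sqrtr_sqr; apply: ler_wsqrtr.
  by rewrite lerDl sqr_ge0.
have imb (x : complex R) : `|complex.Im x|%:C%C <= `|x|.
  rewrite normc_def lecR -sqrtr_sqr; apply: ler_wsqrtr.
  by rewrite lerDr sqr_ge0.
have /cvg_ex[a Fa] : cvg ((@complex.Re R) @ F).
  by apply: cv reb => -[? ?] [? ?].
have /cvg_ex[b Fb] : cvg ((@complex.Im R) @ F).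
  by apply: cv imb => -[? ?] [? ?].
apply/cvg_ex; exists (a +i* b)%C.
apply/cvgrPdist_lt => /= e e0.
have eE : e = (complex.Re e)%:C%C.
  by move: e0; rewrite ltcE => /andP[/eqP/= ie _]; case: e ie => u v /= ->.
have e20 : 0 < complex.Re e / 2.
  by move: e0; rewrite ltcE => /andP[_ re0]; rewrite divr_gt0.
have ha : \forall z \near F, `|a - complex.Re z| < complex.Re e / 2.
  by move/cvgrPdist_lt : Fa => /(_ _ e20).
have hb : \forall z \near F, `|b - complex.Im z| < complex.Re e / 2.
  by move/cvgrPdist_lt : Fb => /(_ _ e20).
apply: filterS2 ha hb => -[u v] /= hu hv.
have -> : ((a +i* b) - (u +i* v))%C = (a - u)%:C%C + (0 +i* (b - v))%C.
  by apply/eqP; rewrite eq_complex /= addr0 add0r !eqxx.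
apply: le_lt_trans (ler_normD _ _) _.
rewrite !normc_def /= expr0n /= addr0 add0r !sqrtr_sqr.
by rewrite -rmorphD/= eE ltcR [ltRHS]splitr ltrD.
Qed.

Lemma scalar_complete (R : realType) (s : scalars)
    (F : set_system ((scalar_field R s)^o)) :
  ProperFilter F -> cauchy F -> cvg F.
Proof. by case: s F => F; [exact: R_complete|exact: complex_complete]. Qed.

Definition bounded_linear (R : realType) (s : scalars)
    (E F : normedModType (scalar_field R s)) (f : E -> F) : Prop :=
  linear f /\ exists M, forall x, `|f x| <= M * `|x|.

Section Dual.
Context (R : realType) (s : scalars).
Local Notation K := (scalar_field R s).

Definition bounded_functional (E : normedModType K) : {pred E -> K^o} :=
  fun f => `[< bounded_linear f >].

Record dual (E : normedModType K) := Dual {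
  dual_fun :> E -> K^o;
  _ : dual_fun \in @bounded_functional E }.

Context (E : normedModType K).

HB.instance Definition _ := [isSub for @dual_fun E].
HB.instance Definition _ := [Choice of dual E by <:].

Lemma bounded_linear_ge0 (F : normedModType K) (f : E -> F) :
  bounded_linear f -> exists2 M, 0 <= M & forall x, `|f x| <= M * `|x|.
Proof.
move=> [_ [M fM]]; exists `|M| => // x.
apply: le_trans (fM x) _.
have [->|x0] := eqVneq x 0; first by rewrite normr0 !mulr0.
have xgt0 : 0 < `|x| by rewrite normr_gt0.
rewrite ler_pM2r//; apply: real_ler_norm; apply: ger0_real.
rewrite -(pmulr_lge0 _ xgt0); exact: le_trans (fM x).
Qed.

Lemma bounded_functional_submod_closed : submod_closed (@bounded_functional E).
Proof.
split.
  apply/asboolP; split; first by move=> a x y; rewrite scaler0 addr0.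
  by exists 0 => x; rewrite mul0r normr0.
move=> a f g /asboolP bf /asboolP bg; apply/asboolP; split.
  move=> k x y; case: bf bg => [lf _] [lg _].
  have -> : forall z, (a *: f + g) z = a *: f z + g z by [].
  have -> : forall z, (a *: f + g) z = a *: f z + g z by [].
  by rewrite lf lg !scalerDr !scalerA (mulrC a) addrACA.
have [M M0 fM] := bounded_linear_ge0 bf.
have [N N0 gN] := bounded_linear_ge0 bg.
exists (`|a| * M + N) => x.
have -> : (a *: f + g) x = a *: f x + g x by [].
apply: le_trans (ler_normD _ _) _.
by rewrite normrZ mulrDl lerD// -mulrA ler_wpM2l.
Qed.

HB.instance Definition _ :=
  GRing.isSubmodClosed.Build K (E -> K^o) (@bounded_functional E)
    bounded_functional_submod_closed.
HB.instance Definition _ := [SubChoice_isSubLmodule of dual E by <:].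

Lemma dualP (f : dual E) : bounded_linear f.
Proof. by case: f => f /= /asboolP. Qed.

Lemma dual_linear (f : dual E) k x y : f (k *: x + y) = k *: f x + f y.
Proof. by case: (dualP f) => lf _; exact: lf. Qed.

Lemma dual0 (f : dual E) : f 0 = 0.
Proof.
by have := dual_linear f (-1) 0 0; rewrite scaler0 addr0 scaleN1r addNr.
Qed.

Lemma dual_ext (f g : dual E) : (forall x, f x = g x) -> f = g.
Proof. by move=> fg; apply/val_inj/funext. Qed.

Definition mk_dual (f : E -> K^o) (bf : bounded_linear f) : dual E :=
  Dual (asboolT bf : f \in @bounded_functional E).

(* The operator norm takes its values in the (real part of the) scalar field,
   as norms over a numFieldType do; it is the least constant M >= 0 with
   `|f x| <= M * `|x| for all x. *)
Definition bounds (f : dual E) : set K :=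
  [set M | 0 <= M /\ forall x, `|f x| <= M * `|x|].

Lemma bounds_least (f : dual E) :
  exists m, bounds f m /\ forall M, bounds f M -> m <= M.
Proof.
have S0 : bounds f !=set0.
  by have [M M0 fM] := bounded_linear_ge0 (dualP f); exists M.
have [|m [mle mge]] := scalar_inf S0; first by move=> c [].
have m0 : 0 <= m by apply: mge => // c [].
exists m; split=> //; split=> // x.
have [->|x0] := eqVneq x 0.
  by rewrite dual0 !normr0 mulr0.
have xgt0 : 0 < `|x| by rewrite normr_gt0.
rewrite -ler_pdivrMr//; apply: mge; first by rewrite divr_ge0.
by move=> c [_ fc]; rewrite ler_pdivrMr.
Qed.

Definition opnorm (f : dual E) : K :=
  xget 0 [set m | bounds f m /\ forall M, bounds f M -> m <= M].

Lemma opnormP (f : dual E) :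
  bounds f (opnorm f) /\ forall M, bounds f M -> opnorm f <= M.
Proof.
rewrite /opnorm; case: xgetP => [m -> //|].
by have [m hm] := bounds_least f => /(_ m).
Qed.

Lemma le_opnormD (f g : dual E) : opnorm (f + g) <= opnorm f + opnorm g.
Proof.
have [[f0 hf] _] := opnormP f; have [[g0 hg] _] := opnormP g.
apply: (opnormP (f + g)).2; split=> [|x]; first exact: addr_ge0.
rewrite mulrDl; apply: le_trans (ler_normD (f x) (g x)) _.
by apply: lerD; [exact: hf|exact: hg].
Qed.

Lemma opnormZ (l : K) (f : dual E) : opnorm (l *: f) = `|l| * opnorm f.
Proof.
have [[f0 hf] fl] := opnormP f; have [[g0 hg] gl] := opnormP (l *: f).
have lfE x : `|(l *: f) x| = `|l| * `|f x| by rewrite -normrZ.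
have le1 : opnorm (l *: f) <= `|l| * opnorm f.
  apply: gl; split=> [|x]; first exact: mulr_ge0.
  by rewrite lfE -mulrA ler_wpM2l//; exact: hf.
apply/eqP; rewrite eq_le le1 /=.
case: (eqVneq l 0) => [l0|l0].
  have -> : `|l| = 0 by rewrite l0 normr0.
  by rewrite mul0r.
have lgt0 : 0 < `|l| by rewrite normr_gt0.
rewrite -ler_pdivlMl//; apply: fl; split=> [|x].
  by rewrite mulr_ge0// invr_ge0.
by rewrite -mulrA ler_pdivlMl// -lfE; exact: hg.
Qed.

Lemma opnorm_eq0 (f : dual E) : opnorm f = 0 -> f = 0.
Proof.
move=> f0; apply: dual_ext => x; apply/eqP; rewrite -normr_le0.
by have [[_ /(_ x)]] := opnormP f; rewrite f0 mul0r.
Qed.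

HB.instance Definition _ :=
  @Lmodule_isNormed.Build K (dual E) opnorm le_opnormD opnormZ opnorm_eq0.

Lemma dual_norm_le (f : dual E) (x : E) : `|f x| <= `|f| * `|x|.
Proof. by have [[_ ]] := opnormP f. Qed.

Lemma dual_norm_ub (f : dual E) (M : K) :
  0 <= M -> (forall x, `|f x| <= M * `|x|) -> `|f| <= M.
Proof. by move=> M0 fM; have [_] := opnormP f; apply. Qed.

Lemma dual_complete (F : set_system (dual E)) :
  ProperFilter F -> cauchy F -> cvg F.
Proof.
move=> FF /cauchy_ballP Fc.
have cvx (x : E) : cvg ((fun f : dual E => f x) @ F).
  apply: scalar_complete; apply/cauchy_ballP => e e0.
  have d0 : 0 < e / (`|x| + 1) by rewrite divr_gt0// ltr_wpDl.
  have := Fc _ d0; rewrite !near_simpl => h; rewrite near_map2.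
  apply: filterS h => -[f g] /=; rewrite -!ball_normE /= => fg.
  have -> : f x - g x = (f - g) x by [].
  apply: le_lt_trans (dual_norm_le _ _) _.
  have : `|f - g| * (`|x| + 1) < e by rewrite -ltr_pdivlMr// ltr_wpDl.
  by apply: le_lt_trans; rewrite ler_wpM2l// lerDl.
pose l x := lim ((fun f : dual E => f x) @ F).
have cvl x : (fun f : dual E => f x) @ F --> l x by exact: cvx.
have near_le (e : K) : 0 < e -> \forall f \near F, forall x, `|l x - (f : dual E) x| <= e * `|x|.
  move=> e0; have h : \forall f \near F, \forall g \near F, ball f e g.
    exact: nearP_dep (Fc e e0).
  apply: filterS h => f fF x.
  apply/ler_addgt0Pr => d d0.
  have [g [fg gx]] : exists g : dual E, `|f - g| < e /\ `|l x - g x| < d.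
    apply: (@filter_ex _ F); apply: filterI.
      by move: fF; rewrite -ball_normE.
    by move/cvgrPdist_lt : (cvl x); exact.
  have -> : l x - f x = (l x - g x) - (f - g) x.
    by rewrite [(f - g) x]/(f x - g x) opprB addrA subrK.
  apply: le_trans (ler_normB _ _) _.
  rewrite [leRHS]addrC; apply: lerD; first exact: ltW.
  apply: le_trans (dual_norm_le _ _) _.
  by rewrite ler_wpM2r// ltW.
have ll : linear l.
  move=> k x y; apply: (@cvg_unique _ (@norm_hausdorff K K^o) _ _ _ _ (cvl _)).
  have -> : (fun f : dual E => f (k *: x + y)) = (fun f : dual E => k *: f x + f y).
    by apply/funext => f; exact: dual_linear.
  by apply: cvgD => //; apply: cvgZr.
have bl : bounded_linear l.
  split=> //; have [f fl] := @filter_ex _ F _ _ (near_le 1 ltr01).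
  exists (1 + `|f|) => x; rewrite -[l x](subrK (f x)) mulrDl.
  by apply: le_trans (ler_normD _ _) _; rewrite lerD// dual_norm_le.
apply/cvg_ex; exists (mk_dual bl); apply/cvgrPdist_le => e e0.
apply: filterS (near_le e e0) => f fe.
by apply: dual_norm_ub => [|x]; [exact: ltW|exact: fe].
Qed.

HB.instance Definition _ := Uniform_isComplete.Build (dual E) dual_complete.

End Dual.

Section BoundedLinearMaps.
Context (R : realType) (s : scalars).
Local Notation K := (scalar_field R s).

Record blin (E F : normedModType K) := Blin {
  blin_fun :> E -> F;
  blinP : bounded_linear blin_fun }.

Lemma dualD (E : normedModType K) (f : dual E) x y : f (x + y) = f x + f y.
Proof. by have := dual_linear f 1 x y; rewrite !scale1r. Qed.

Lemma dualZ (E : normedModType K) (f : dual E) k x : f (k *: x) = k *: f x.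
Proof. by have := dual_linear f k x 0; rewrite addr0 dual0 addr0. Qed.

Section Adjoint.
Context (E F : normedModType K) (T : blin E F).

Lemma adjoint_subproof (f : dual F) :
  bounded_linear (fun x => f (T x) : K^o).
Proof.
have [M M0 TM] := bounded_linear_ge0 (blinP T).
split=> [k x y|].
  by have [lT _] := blinP T; rewrite lT dual_linear.
exists (`|f| * M) => x; apply: le_trans (dual_norm_le _ _) _.
by rewrite -mulrA ler_wpM2l.
Qed.

(* <T' f, x> = <f, T x> *)
Definition adjoint_fun (f : dual F) : dual E := mk_dual (adjoint_subproof f).

Lemma adjoint_bounded : bounded_linear adjoint_fun.
Proof.
have [M M0 TM] := bounded_linear_ge0 (blinP T).
split=> [k f g|]; first exact: dual_ext.
exists M => f; apply: dual_norm_ub => [|x]; first exact: mulr_ge0.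
apply: le_trans (dual_norm_le f (T x)) _.
by rewrite (mulrC M) -mulrA ler_wpM2l.
Qed.

Definition adjoint : blin (dual F) (dual E) := Blin adjoint_bounded.

End Adjoint.

Section Canonical.
Context (E : normedModType K).

Lemma canon_subproof (x : E) : bounded_linear (fun f : dual E => f x : K^o).
Proof.
by split=> [k f g //|]; exists `|x| => f; rewrite mulrC dual_norm_le.
Qed.

Definition canon (x : E) : dual (dual E) := mk_dual (canon_subproof x).

Definition reflexive_space : Prop := forall F : dual (dual E), exists x, canon x = F.

(* weak_star is dual E with the weak* topology induced by E; weak is E with the
   weak topology induced by dual E. *)
Definition weak_star : Type :=
  initial_topology ((fun f => f) : dual E -> {ptws E -> K^o}).
HB.instance Definition _ := Topological.on weak_star.

Definition weak : Type :=
  initial_topology ((fun x f => f x) : E -> {ptws dual E -> K^o}).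
HB.instance Definition _ := Topological.on weak.

End Canonical.

Lemma initial_cvgP (S : choiceType) (T : topologicalType) (f : S -> T)
    (F : set_system S) (x : S) : Filter F ->
  F --> (x : initial_topology f) <-> f @ F --> f x.
Proof.
move=> FF; split=> [Fx|fFx].
  move=> A /(@initial_continuous _ _ f x) Ax; exact: Fx.
move=> A [B [[C oC <-] Cx] CA]; apply: filterS CA _.
by apply: fFx; apply: open_nbhs_nbhs; split.
Qed.

Lemma weak_star_cvgP (E : normedModType K) (F : set_system (dual E))
    (f : dual E) : Filter F ->
  F --> (f : weak_star E) <-> forall x, (fun g : dual E => g x) @ F --> f x.
Proof.
move=> FF; apply: iff_trans (initial_cvgP _ _ FF) _.
exact: pointwise_cvgP.
Qed.

Lemma weak_cvgP (E : normedModType K) (F : set_system E) (x : E) : Filter F ->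
  F --> (x : weak E) <-> forall f : dual E, f @ F --> f x.
Proof.
move=> FF; apply: iff_trans (initial_cvgP _ _ FF) _.
exact: pointwise_cvgP.
Qed.

End BoundedLinearMaps.

Reserved Notation "x ** y" (at level 40, left associativity).

(* Algebras need not be unital, so the ring structures do not apply. *)
Record banachAlgebra (R : realType) (s : scalars) := BanachAlgebra {
  ba_space :> completeNormedModType (scalar_field R s);
  ba_mul : ba_space -> ba_space -> ba_space;
  ba_mulA : associative ba_mul;
  ba_mul_linearl : forall y, linear (ba_mul^~ y);
  ba_mul_linearr : forall x, linear (ba_mul x);
  ba_mul_norm : forall x y, `|ba_mul x y| <= `|x| * `|y| }.

Notation "x ** y" := (ba_mul x y) : ring_scope.

Record banachBimodule (R : realType) (s : scalars) (A : banachAlgebra R s) :=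
BanachBimodule {
  bb_space :> completeNormedModType (scalar_field R s);
  lact : A -> bb_space -> bb_space;
  ract : bb_space -> A -> bb_space;
  lact_linearl : forall x, linear (lact^~ x);
  lact_linearr : forall a, linear (lact a);
  ract_linearl : forall a, linear (ract^~ a);
  ract_linearr : forall x, linear (ract x);
  lactA : forall a b x, lact (a ** b) x = lact a (lact b x);
  ractA : forall x a b, ract x (a ** b) = ract (ract x a) b;
  lractA : forall a x b, ract (lact a x) b = lact a (ract x b);
  lact_norm : exists2 c, 0 <= c & forall a x, `|lact a x| <= c * `|a| * `|x|;
  ract_norm : exists2 c, 0 <= c & forall x a, `|ract x a| <= c * `|x| * `|a| }.

Section Bimodules.
Context (R : realType) (s : scalars) (A : banachAlgebra R s).
Local Notation K := (scalar_field R s).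

Lemma ba_mul_norm1 :
  exists2 c : K, 0 <= c & forall a b : A, `|a ** b| <= c * `|a| * `|b|.
Proof. by exists 1 => // a b; rewrite mul1r ba_mul_norm. Qed.

Definition regular_bimodule : banachBimodule A :=
  @BanachBimodule R s A A (@ba_mul R s A) (@ba_mul R s A)
    (@ba_mul_linearl R s A) (@ba_mul_linearr R s A)
    (@ba_mul_linearl R s A) (@ba_mul_linearr R s A)
    (fun a b x => esym (ba_mulA a b x)) (@ba_mulA R s A)
    (fun a x b => esym (ba_mulA a x b)) ba_mul_norm1 ba_mul_norm1.

Context (B : banachBimodule A).

Lemma lact_bounded (a : A) : bounded_linear (@lact _ _ _ B a).
Proof.
split; first exact: lact_linearr.
by have [c _ cP] := lact_norm B; exists (c * `|a|) => x; exact: cP.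
Qed.

Lemma ract_bounded (a : A) : bounded_linear ((@ract _ _ _ B)^~ a).
Proof.
split; first exact: ract_linearl.
have [c _ cP] := ract_norm B; exists (c * `|a|) => x.
by rewrite mulrAC; exact: cP.
Qed.

(* <a f, x> = <f, x a> *)
Definition dual_lact (a : A) (f : dual B) : dual B :=
  adjoint (Blin (ract_bounded a)) f.

(* <f a, x> = <f, a x> *)
Definition dual_ract (f : dual B) (a : A) : dual B :=
  adjoint (Blin (lact_bounded a)) f.

Lemma dual_lact_norm :
  exists2 c, 0 <= c & forall a f, `|dual_lact a f| <= c * `|a| * `|f|.
Proof.
have [c c0 cP] := ract_norm B; exists c => // a f.
apply: dual_norm_ub => [|x]; first by rewrite !mulr_ge0.
apply: le_trans (dual_norm_le f (ract x a)) _.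
rewrite mulrAC [leRHS]mulrC.
by rewrite ler_wpM2l// mulrAC; exact: cP.
Qed.

Lemma dual_ract_norm :
  exists2 c, 0 <= c & forall f a, `|dual_ract f a| <= c * `|f| * `|a|.
Proof.
have [c c0 cP] := lact_norm B; exists c => // f a.
apply: dual_norm_ub => [|x]; first by rewrite !mulr_ge0.
apply: le_trans (dual_norm_le f (lact a x)) _.
rewrite (mulrC c) -!mulrA ler_wpM2l// mulrA; exact: cP.
Qed.

Definition dual_bimodule : banachBimodule A.
Proof.
apply: (@BanachBimodule R s A (dual B) dual_lact dual_ract) => //.
- move=> f k a b; apply: dual_ext => x /=.
  by rewrite [LHS](congr1 f (ract_linearr x k a b)) dual_linear.
- by move=> a k f g; exact: dual_ext.
- by move=> a k f g; exact: dual_ext.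
- move=> f k a b; apply: dual_ext => x /=.
  by rewrite [LHS](congr1 f (lact_linearl x k a b)) dual_linear.
- by move=> a b f; apply: dual_ext => x; exact: (congr1 f (ractA x a b)).
- by move=> f a b; apply: dual_ext => x; exact: (congr1 f (lactA a b x)).
- by move=> a f b; apply: dual_ext => x; exact: (congr1 f (lractA b x a)).
- exact: dual_lact_norm.
- exact: dual_ract_norm.
Defined.

End Bimodules.

Section Arens.
Context (R : realType) (s : scalars) (A : banachAlgebra R s).
Local Notation K := (scalar_field R s).
Local Notation A' := (dual_bimodule (regular_bimodule A)).
Local Notation A'' := (dual (dual A)).

Lemma lact_regular_norm (a : A) (f : A') : `|lact a f| <= `|a| * `|f|.
Proof.
apply: dual_norm_ub => [|x]; first by rewrite mulr_ge0.
apply: le_trans (dual_norm_le f (x ** a)) _.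
by rewrite (mulrC `|a|) -mulrA ler_wpM2l// mulrC ba_mul_norm.
Qed.

Lemma ract_regular_norm (f : A') (a : A) : `|ract f a| <= `|f| * `|a|.
Proof.
apply: dual_norm_ub => [|x]; first by rewrite mulr_ge0.
apply: le_trans (dual_norm_le f (a ** x)) _.
by rewrite -mulrA ler_wpM2l// ba_mul_norm.
Qed.

Lemma bidual_lact_subproof (G : A'') (f : A') :
  bounded_linear (fun a => G (ract f a) : K^o).
Proof.
split=> [k a b|]; first by rewrite ract_linearr dual_linear.
exists (`|G| * `|f|) => a; apply: le_trans (dual_norm_le _ _) _.
by rewrite -mulrA ler_wpM2l// ract_regular_norm.
Qed.

(* <G f, a> = <G, f a> *)
Definition bidual_lact (G : A'') (f : A') : A' :=
  mk_dual (bidual_lact_subproof G f).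

Lemma bidual_lact_norm (G : A'') (f : A') : `|bidual_lact G f| <= `|G| * `|f|.
Proof.
apply: dual_norm_ub => [|a]; first by rewrite mulr_ge0.
apply: le_trans (dual_norm_le G (ract f a)) _.
by rewrite -mulrA ler_wpM2l// ract_regular_norm.
Qed.

Lemma bidual_ract_subproof (f : A') (F : A'') :
  bounded_linear (fun a => F (lact a f) : K^o).
Proof.
split=> [k a b|]; first by rewrite lact_linearl dual_linear.
exists (`|F| * `|f|) => a; apply: le_trans (dual_norm_le _ _) _.
by rewrite -mulrA ler_wpM2l// mulrC lact_regular_norm.
Qed.

(* <f F, a> = <F, a f> *)
Definition bidual_ract (f : A') (F : A'') : A' :=
  mk_dual (bidual_ract_subproof f F).

Lemma bidual_ract_norm (f : A') (F : A'') : `|bidual_ract f F| <= `|f| * `|F|.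
Proof.
apply: dual_norm_ub => [|a]; first by rewrite mulr_ge0.
apply: le_trans (dual_norm_le F (lact a f)) _.
by rewrite (mulrC `|f|) -mulrA ler_wpM2l// mulrC lact_regular_norm.
Qed.

Lemma arens1_subproof (F G : A'') :
  bounded_linear (fun f : dual A => F (bidual_lact G f) : K^o).
Proof.
split=> [k f g|].
  rewrite -dual_linear; congr (F _); apply: dual_ext => a.
  apply: etrans (dual_linear G k (ract (f : A') a) (ract (g : A') a)).
  by congr (G _); exact: (@ract_linearl _ _ _ A' a k f g).
exists (`|F| * `|G|) => f; apply: le_trans (dual_norm_le _ _) _.
by rewrite -mulrA ler_wpM2l// bidual_lact_norm.
Qed.

(* First Arens product, <F G, f> = <F, G f>. Lemma arens1_iterated_limit shows
   that it is w*-lim_i w*-lim_j a_i b_j whenever a_i -> F and b_j -> G weak*. *)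
Definition arens1 (F G : A'') : A'' := mk_dual (arens1_subproof F G).

Lemma arens2_subproof (F G : A'') :
  bounded_linear (fun f : dual A => G (bidual_ract f F) : K^o).
Proof.
split=> [k f g|].
  rewrite -dual_linear; congr (G _); apply: dual_ext => a.
  apply: etrans (dual_linear F k (lact a (f : A')) (lact a (g : A'))).
  by congr (F _); exact: (@lact_linearr _ _ _ A' a k f g).
exists (`|G| * `|F|) => f; apply: le_trans (dual_norm_le _ _) _.
by rewrite -mulrA ler_wpM2l// mulrC bidual_ract_norm.
Qed.

(* Second Arens product, <F o G, f> = <G, f F>; by arens2_iterated_limit it is
   w*-lim_j w*-lim_i a_i b_j. *)
Definition arens2 (F G : A'') : A'' := mk_dual (arens2_subproof F G).

Lemma arens1A : associative arens1.
Proof.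
move=> F G H; apply: dual_ext => f.
apply: (congr1 F); apply: dual_ext => a.
apply: (congr1 G); apply: dual_ext => b.
by apply: (congr1 H); rewrite ractA.
Qed.

Lemma arens1_norm F G : `|arens1 F G| <= `|F| * `|G|.
Proof.
apply: dual_norm_ub => [|f]; first by rewrite mulr_ge0.
apply: le_trans (dual_norm_le F (bidual_lact G f)) _.
by rewrite -mulrA ler_wpM2l// bidual_lact_norm.
Qed.

Lemma arens1_linearl G : linear (arens1^~ G).
Proof. by move=> k F F'; exact: dual_ext. Qed.

Lemma arens1_linearr F : linear (arens1 F).
Proof.
move=> k G G'; apply: dual_ext => f.
apply: etrans (dual_linear F k (bidual_lact G f) (bidual_lact G' f)).
by congr (F _); exact: dual_ext.
Qed.

(* A** with the first Arens product. *)
Definition bidual_algebra : banachAlgebra R s :=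
  BanachAlgebra arens1A arens1_linearl arens1_linearr arens1_norm.

Definition arens_regular : Prop := forall F G : A'', arens1 F G = arens2 F G.

End Arens.

Record directedSet := DirectedSet {
  ds_carrier :> Type;
  ds_le : ds_carrier -> ds_carrier -> Prop;
  ds_point : ds_carrier;
  ds_refl : forall i, ds_le i i;
  ds_trans : forall i j k, ds_le i j -> ds_le j k -> ds_le i k;
  ds_directed : forall i j, exists k, ds_le i k /\ ds_le j k }.

Definition tails (I : directedSet) : set_system I :=
  [set S | exists i, forall j, ds_le i j -> S j].

Arguments tails : clear implicits.

Global Instance tails_proper (I : directedSet) : ProperFilter (tails I).
Proof.
split; first by move=> [i /(_ _ (ds_refl i))].
split; first by exists (ds_point I).
  move=> P Q [i iP] [j jQ]; have [k [ik jk]] := ds_directed i j.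
  exists k => l kl; split; [apply: iP|apply: jQ]; exact: ds_trans kl.
by move=> P Q PQ [i iP]; exists i => j /iP /PQ.
Qed.

Section Nets.
Context (R : realType) (s : scalars).
Local Notation K := (scalar_field R s).

Definition bounded_net (E : normedModType K) (I : directedSet) (x : I -> E) :=
  exists M, forall i, `|x i| <= M.

Definition weak_star_cvg (E : normedModType K) (I : directedSet)
    (f : I -> dual E) (g : dual E) : Prop :=
  f @ tails I --> (g : weak_star E).

Definition weak_cvg (E : normedModType K) (I : directedSet)
    (x : I -> E) (y : E) : Prop :=
  x @ tails I --> (y : weak E).

Context (A : banachAlgebra R s).

Lemma arens1_iterated_limit (I J : directedSet) (a : I -> A) (b : J -> A)
    (F G : dual (dual A)) :
  weak_star_cvg (fun i => canon (a i)) F ->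
  weak_star_cvg (fun j => canon (b j)) G ->
  (forall i, weak_star_cvg (fun j => canon (a i ** b j))
                           (arens1 (canon (a i)) G)) /\
  weak_star_cvg (fun i => arens1 (canon (a i)) G) (arens1 F G).
Proof.
move=> /weak_star_cvgP aF /weak_star_cvgP bG; split=> [i|]; apply/weak_star_cvgP.
  move=> f; exact: (bG (@ract _ _ _ (dual_bimodule (regular_bimodule A)) f (a i))).
by move=> f; exact: (aF (bidual_lact G f)).
Qed.

Lemma arens2_iterated_limit (I J : directedSet) (a : I -> A) (b : J -> A)
    (F G : dual (dual A)) :
  weak_star_cvg (fun i => canon (a i)) F ->
  weak_star_cvg (fun j => canon (b j)) G ->
  (forall j, weak_star_cvg (fun i => canon (a i ** b j))
                           (arens2 F (canon (b j)))) /\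
  weak_star_cvg (fun j => arens2 F (canon (b j))) (arens2 F G).
Proof.
move=> /weak_star_cvgP aF /weak_star_cvgP bG; split=> [j|]; apply/weak_star_cvgP.
  move=> f; exact: (aF (@lact _ _ _ (dual_bimodule (regular_bimodule A)) (b j) f)).
by move=> f; exact: (bG (bidual_ract f F)).
Qed.

Definition left_approximate_identity (I : directedSet) (e : I -> A) : Prop :=
  forall a, (fun i => e i ** a) @ tails I --> a.

Definition has_bounded_left_approximate_identity : Prop :=
  exists (I : directedSet) (e : I -> A),
    bounded_net e /\ left_approximate_identity e.

Definition is_derivation (E : banachBimodule A) (D : blin A E) : Prop :=
  forall x y, D (x ** y) = lact x (D y) + ract (D x) y.

Context (B : banachBimodule A).

(* The Lw*wc-, Rw*wc- and w*wc-properties with respect to A, for an element of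
   B* and for B* itself. *)
Definition Lwstarwc_elt (f : dual_bimodule B) : Prop :=
  forall (I : directedSet) (a : I -> A), bounded_net a ->
    weak_star_cvg (fun i => ract f (a i) : dual B) 0 ->
    weak_cvg (fun i => ract f (a i) : dual B) 0.

Definition Rwstarwc_elt (f : dual_bimodule B) : Prop :=
  forall (I : directedSet) (a : I -> A), bounded_net a ->
    weak_star_cvg (fun i => lact (a i) f : dual B) 0 ->
    weak_cvg (fun i => lact (a i) f : dual B) 0.

Definition wstarwc_elt (f : dual_bimodule B) : Prop :=
  Lwstarwc_elt f /\ Rwstarwc_elt f.

Definition Lwstarwc : Prop := forall f, Lwstarwc_elt f.
Definition Rwstarwc : Prop := forall f, Rwstarwc_elt f.
Definition wstarwc : Prop := forall f, wstarwc_elt f.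

End Nets.

(* Main.v *)
From HB Require Import structures.
From mathcomp Require Import all_boot all_order all_algebra.
From mathcomp Require Import complex.
From mathcomp Require Import all_classical reals topology normedtype sequences.
Require Import Defs.
Set Implicit Arguments.
Unset Strict Implicit.
Unset Printing Implicit Defensive.
Import Order.TTheory GRing.Theory Num.Theory.
Import numFieldNormedType.Exports.
Local Open Scope classical_set_scope.
Local Open Scope ring_scope.

(** Write XF for the first Arens product, D' : A** -> A* and D'' : A** -> A***
    for the adjoints of D, and let F, G, X range over A**. The derivation
    identity for D'' says, after evaluation at X,
      <D''G, XF> = <FG, D'X> - <D''F, GX> = <F, G.D'X - D'(GX)>,
    so the functional F |-> <D''G, XF> on A** is evaluation at an element of A*.
    As D is onto, so is D'': D' is bounded below by the uniform boundedness
    principle, and Hahn-Banach then extends functionals from the range of D'.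
    Hence every functional F |-> <L, XF>, L in A***, is evaluation at some g in
    A* (surjective_derivation_representable), and this one fact gives all four
    assertions.

    It is the weak*-to-weak continuity of F |-> XF, tested on functionals.
    For L = canon f, comparing both sides on the canonical image of A identifies
    g as the functional fX : a |-> <X, af>, and this is the equality of the two
    Arens products. For the wc-properties, a bounded net in A is followed along
    an ultrafilter to a weak* limit F in A**; the hypothesis kills a product of
    F with the given element, and the limit of the net under a functional is a
    value of that product. Finally, a weak* limit E of a bounded left approximate
    identity satisfies EF = F by Arens regularity, so every L in A*** is
    evaluation at an element of A*; hence L vanishes as soon as it vanishes on
    A, and A, being complete, is closed in A**, so Hahn-Banach forces A = A**. *)

(** * Real and complex scalars *)

Section Scalars.
Context (R : realType) (s : scalars).
Local Notation K := (scalar_field R s).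

Definition ofR : R -> K :=
  match s return R -> scalar_field R s with
  | Reals => id
  | Complexes => fun r => r%:C%C
  end.

Definition toR : K -> R :=
  match s return scalar_field R s -> R with
  | Reals => id
  | Complexes => fun z => complex.Re z
  end.

Lemma ofR1 : ofR 1 = 1. Proof. by rewrite /ofR; case: s. Qed.

Lemma ofRD x y : ofR (x + y) = ofR x + ofR y.
Proof. by rewrite /ofR; case: s => //; rewrite rmorphD. Qed.

Lemma ofRM x y : ofR (x * y) = ofR x * ofR y.
Proof. by rewrite /ofR; case: s => //; rewrite rmorphM. Qed.

Lemma ler_ofR x y : (ofR x <= ofR y) = (x <= y).
Proof. by rewrite /ofR; case: s => //; rewrite lecR. Qed.

Lemma ltr_ofR x y : (ofR x < ofR y) = (x < y).
Proof. by rewrite /ofR; case: s => //; rewrite ltcR. Qed.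

Lemma ofR_norm x : `|ofR x| = ofR `|x|.
Proof. by rewrite /ofR; case: s => //; rewrite normc_def /= expr0n /= addr0 sqrtr_sqr. Qed.

Lemma ofRK : cancel ofR toR.
Proof. by rewrite /ofR /toR; case: s. Qed.

Lemma ofR0 : ofR 0 = 0.
Proof. by apply: (addrI (ofR 0)); rewrite -ofRD !addr0. Qed.

Lemma toRK (k : K) : 0 <= k -> ofR (toR k) = k.
Proof.
rewrite /ofR /toR; case: s k => //= -[a b]; rewrite lecE /= => /andP[/eqP -> _].
by [].
Qed.

Lemma toR_norm_ge0 (E : normedModType K) (x : E) : 0 <= toR `|x|.
Proof. by rewrite -ler_ofR ofR0 toRK. Qed.

Lemma toRD k l : toR (k + l) = toR k + toR l.
Proof. by rewrite /toR; case: s k l => //= -[? ?] [? ?]. Qed.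

Lemma toR_ofRM r k : toR (ofR r * k) = r * toR k.
Proof. by rewrite /toR /ofR; case: s k => //= -[? ?] /=; rewrite mul0r subr0. Qed.

Lemma toR_le_norm (k : K) : toR k <= toR `|k|.
Proof.
rewrite /toR; case: s k => [|[a b]]; first exact: ler_norm.
have -> : `|(a +i* b)%C : scalar_field R Complexes| = (Num.sqrt (a ^+ 2 + b ^+ 2))%:C%C.
  exact: normc_def.
rewrite /=.
apply: le_trans (ler_norm a) _; rewrite -sqrtr_sqr; apply: ler_wsqrtr.
by rewrite lerDl sqr_ge0.
Qed.

Lemma toR0 : toR 0 = 0. Proof. by rewrite -ofR0 ofRK. Qed.

Lemma toRN k : toR (- k) = - toR k.
Proof. by apply/eqP; rewrite -subr_eq0 opprK -toRD addNr toR0. Qed.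

Lemma toR_norm_le (k : K) : `|toR k| <= toR `|k|.
Proof. by rewrite ler_norml toR_le_norm andbT lerNl -toRN -normrN toR_le_norm. Qed.

Lemma ler_toR (k l : K) : 0 <= k -> k <= l -> toR k <= toR l.
Proof.
by move=> k0 kl; rewrite -ler_ofR !toRK// (le_trans k0).
Qed.

End Scalars.
Arguments ofR {R s}.
Arguments toR {R s}.

Section Realify.
Context (R : realType) (s : scalars).
Local Notation K := (scalar_field R s).

(** The real space underlying E, as an alias that carries the real structures;
    it makes theorems on real spaces available for complex ones. *)
Definition realify (E : lmodType K) : Type := E.

Section Lmodule.
Context (E : lmodType K).

HB.instance Definition _ := GRing.Zmodule.on (realify E).

Definition realify_scale (r : R) (x : realify E) : realify E := ofR r *: (x : E).

Lemma realify_scaleA a b v :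
  realify_scale a (realify_scale b v) = realify_scale (a * b) v.
Proof. by rewrite /realify_scale scalerA ofRM. Qed.

Lemma realify_scale1 : left_id 1 realify_scale.
Proof. by move=> v; rewrite /realify_scale ofR1 scale1r. Qed.

Lemma realify_scaleDr : right_distributive realify_scale +%R.
Proof. by move=> a u v; rewrite /realify_scale scalerDr. Qed.

Lemma realify_scaleDl v : {morph realify_scale^~ v : a b / a + b}.
Proof. by move=> a b; rewrite /realify_scale ofRD scalerDl. Qed.

HB.instance Definition _ := GRing.Zmodule_isLmodule.Build R (realify E)
  realify_scaleA realify_scale1 realify_scaleDr realify_scaleDl.

End Lmodule.

Context (E : normedModType K).

Definition realify_norm (x : realify E) : R := toR `|x : E|.

Lemma ofR_realify_norm (x : realify E) : ofR (realify_norm x) = `|x : E|.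
Proof. exact: toRK. Qed.

Lemma realify_normD x y :
  realify_norm (x + y) <= realify_norm x + realify_norm y.
Proof.
rewrite -(@ler_ofR R s) ofRD !ofR_realify_norm; exact: (ler_normD (x : E)).
Qed.

Lemma realify_normZ (l : R) x : realify_norm (l *: x) = `|l| * realify_norm x.
Proof.
by rewrite /realify_norm [X in `|X|]/(ofR l *: (x : E)) normrZ ofR_norm toR_ofRM.
Qed.

Lemma realify_norm_eq0 x : realify_norm x = 0 -> x = 0.
Proof.
move=> x0; apply: (@normr0_eq0 _ E); by rewrite -ofR_realify_norm x0 ofR0.
Qed.

HB.instance Definition _ := @Lmodule_isNormed.Build R (realify E)
  realify_norm realify_normD realify_normZ realify_norm_eq0.

End Realify.

Section RealifyComplete.
Context (R : realType) (s : scalars) (E : completeNormedModType (scalar_field R s)).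

Lemma realify_complete (F : set_system (realify E)) :
  ProperFilter F -> cauchy F -> cvg F.
Proof.
move=> FF /cauchy_ballP Fc.
have bE (x y : E) (e : scalar_field R s) : 0 <= e ->
    (`|x - y| < e) = (`|(x : realify E) - y| < toR e).
  by move=> e0; rewrite -(@ltr_ofR R s) toRK// ofR_realify_norm.
have /cvg_ex[l Fl] : cvg (F : set_system E).
  apply: cauchy_cvg; apply/cauchy_ballP => e e0.
  have /Fc : 0 < toR e by rewrite -(@ltr_ofR R s) ofR0 toRK// ltW.
  apply: filterS => -[x y]; rewrite -!ball_normE /= => xy.
  by rewrite bE// ltW.
apply/cvg_ex; exists l; apply/cvgrPdist_lt => e e0.
have e0' : 0 < ofR e :> scalar_field R s by rewrite -ofR0 ltr_ofR.
move/cvgrPdist_lt : Fl => /(_ _ e0').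
by apply: filterS => x; rewrite bE ?ofRK// ltW.
Qed.

HB.instance Definition _ := Uniform_isComplete.Build (realify E) realify_complete.

End RealifyComplete.

(** * Sublinear functionals and the real Hahn-Banach theorem *)

Section Sublinear.
Context (R : realType) (V : lmodType R).
Implicit Types (p q : V -> R).

(** Homogeneity is an inequality because infima inherit it in that form; applied
    to t and its inverse it forces equality. *)
Definition sublinear p : Prop :=
  (forall x y, p (x + y) <= p x + p y) /\
  (forall t x, 0 < t -> p (t *: x) <= t * p x).

Lemma sublinear0 p : sublinear p -> p 0 = 0.
Proof.
move=> [_ ph]; have h2 := ph 2 0 (ltr0n _ 2).
have hh := ph 2^-1 0; rewrite invr_gt0 ltr0n in hh; have {}hh := hh isT.
rewrite !scaler0 in h2 hh; apply/eqP; rewrite eq_le; apply/andP; split.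
  by move: hh; rewrite ler_pdivlMl// mulr_natl mulr2n gerDl.
by move: h2; rewrite mulr_natl mulr2n lerDl.
Qed.

Lemma sublinearN p x : sublinear p -> - p (- x) <= p x.
Proof.
move=> sp; rewrite -subr_ge0 opprK -(sublinear0 sp) -(subrr x).
exact: sp.1.
Qed.

Lemma sublinearZ p t x : sublinear p -> 0 <= t -> p (t *: x) = t * p x.
Proof.
move=> sp; rewrite le_eqVlt => /predU1P[<-|t0].
  by rewrite scale0r mul0r sublinear0.
apply/eqP; rewrite eq_le sp.2//= -ler_pdivlMl//.
by rewrite -[in leLHS](scalerK (lt0r_neq0 t0) x) sp.2// invr_gt0.
Qed.

(** The infimal convolution q x = inf (p (x - y) + a), over a convex cone C of
    constraints q y <= a, is the largest sublinear function below p that obeys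
    them. The bound - p (- x) <= a is what keeps the infimum finite. *)
Lemma sublinear_minorant p (C : V -> R -> Prop) : sublinear p ->
  C 0 0 ->
  (forall x a y b, C x a -> C y b -> C (x + y) (a + b)) ->
  (forall t x a, 0 < t -> C x a -> C (t *: x) (t * a)) ->
  (forall x a, C x a -> - p (- x) <= a) ->
  exists q, [/\ sublinear q, forall x, q x <= p x & forall x a, C x a -> q x <= a].
Proof.
move=> sp C0 CD CZ Cp.
pose S x := [set r | exists y a, C y a /\ r = p (x - y) + a].
have hS x : has_inf (S x).
  split; first by exists (p (x - 0) + 0), 0, 0.
  exists (- p (- x)) => _ [y [a [/Cp pa ->]]].
  rewrite (le_trans _ (lerD (lexx _) pa))// lerBrDr addrC -lerBrDr opprK.
  by have := sp.1 (x - y) (- x); rewrite addrAC subrr add0r.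
have Sle x y a : C y a -> inf (S x) <= p (x - y) + a.
  by move=> Ca; apply: (ge_inf (hS x).2); exists y, a.
exists (fun x => inf (S x)); split.
- split=> [x y|t x t0].
    rewrite -lerBlDr; apply: (lb_le_inf (hS x).1) => _ [u [a [Cu ->]]].
    rewrite lerBlDr [leRHS]addrC -lerBlDr.
    apply: (lb_le_inf (hS y).1) => _ [v [b [Cv ->]]].
    rewrite lerBlDr (le_trans (Sle _ _ _ (CD _ _ _ _ Cu Cv)))//.
    have -> : x + y - (u + v) = (y - v) + (x - u).
      by rewrite opprD addrACA addrC.
    by rewrite (addrC a) [leRHS]addrACA lerD// sp.1.
  rewrite -ler_pdivrMl//; apply: (lb_le_inf (hS x).1) => _ [u [a [Cu ->]]].
  rewrite ler_pdivrMl// (le_trans (Sle _ _ _ (CZ t _ _ t0 Cu)))//.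
  by rewrite -scalerBr mulrDr lerD// sp.2.
- by move=> x; have := Sle x _ _ C0; rewrite subr0 addr0.
- by move=> x a /(Sle x); rewrite subrr sublinear0// add0r.
Qed.

(** Zorn's lemma: the infimum of a chain of sublinear functions below p is
    sublinear, and finite because each member is at least - p (- x). *)
Lemma minimal_sublinear p : sublinear p ->
  exists u, [/\ sublinear u, forall x, u x <= p x &
    forall q, sublinear q -> (forall x, q x <= u x) -> forall x, u x <= q x].
Proof.
move=> sp.
pose P q := sublinear q /\ forall x, q x <= p x.
pose T := {q : V -> R | P q}.
pose r (a b : T) := `[< forall x, sval b x <= sval a x >].
pose p0 : T := exist P p (conj sp (fun x => lexx _)).
have [|f g h|A Atot|m mP] := ZL_preorder p0 (R := r).
- by move=> t; apply/asboolP.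
- move=> /asboolP fg /asboolP gh; apply/asboolP => x.
  exact: le_trans (gh x) (fg x).
- have [[a0 Aa0]|A0] := pselect (A !=set0); last first.
    by exists p0 => a Aa; exfalso; apply: A0; exists a.
  pose S x := [set sval a x | a in A].
  have hS x : has_inf (S x).
    split; first by exists (sval a0 x), a0.
    exists (- p (- x)) => _ [[q [sq qp]] Aq <-] /=.
    by apply: le_trans (sublinearN _ sq); rewrite lerN2.
  have Sle x a : A a -> inf (S x) <= sval a x.
    by move=> Aa; apply: (ge_inf (hS x).2); exists a.
  have sS : sublinear (fun x => inf (S x)).
    split=> [x y|t x t0].
      rewrite -lerBlDr; apply: (lb_le_inf (hS x).1) => _ [a Aa <-].
      rewrite lerBlDr [leRHS]addrC -lerBlDr.
      apply: (lb_le_inf (hS y).1) => _ [b Ab <-].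
      rewrite lerBlDr.
      have [c [Ac ca cb]] :
          exists c, [/\ A c, sval c x <= sval a x & sval c y <= sval b y].
        have [/asboolP ab|/asboolP ba] := Atot _ _ Aa Ab.
          by exists b.
        by exists a.
      apply: le_trans (Sle _ _ Ac) _; apply: le_trans ((svalP c).1.1 _ _) _.
      by rewrite addrC lerD.
    rewrite -ler_pdivrMl//; apply: (lb_le_inf (hS x).1) => _ [a Aa <-].
    rewrite ler_pdivrMl// (le_trans (Sle _ _ Aa))//.
    exact: (svalP a).1.2.
  have Sp x : inf (S x) <= p x by apply: le_trans (Sle x _ Aa0) ((svalP a0).2 x).
  exists (exist P _ (conj sS Sp)) => a Aa; apply/asboolP => x; exact: Sle.
exists (sval m); split; [exact: (svalP m).1|exact: (svalP m).2|move=> q sq qm].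
have qp x : q x <= p x by apply: le_trans (qm x) ((svalP m).2 x).
have /asboolP := mP (exist P q (conj sq qp)) (asboolT qm).
exact.
Qed.

(** Imposing the further constraints u (- t x) <= - t u x, for t >= 0, on a
    minimal u cannot lower it, hence u (- x) = - u x; an odd sublinear
    function is linear. *)
Lemma minimal_sublinear_linear (u : V -> R) : sublinear u ->
  (forall q, sublinear q -> (forall x, q x <= u x) -> forall x, u x <= q x) ->
  linear (u : V -> R^o).
Proof.
move=> su umin.
have uN x : u (- x) = - u x.
  have [||||q [sq qu qC]] := @sublinear_minorant u
      (fun y a => exists2 t, 0 <= t & y = t *: (- x) /\ a = - (t * u x)) su.
  - by exists 0; rewrite ?scale0r ?mul0r ?oppr0.
  - move=> _ _ _ _ [t t0 [-> ->]] [t' t'0 [-> ->]].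
    exists (t + t'); first exact: addr_ge0.
    by rewrite scalerDl mulrDl opprD.
  - move=> c _ _ c0 [t t0 [-> ->]].
    exists (c * t); first exact: mulr_ge0 (ltW c0) t0.
    by rewrite scalerA mulrN mulrA.
  - by move=> _ _ [t t0 [-> ->]]; rewrite scalerN opprK sublinearZ.
  apply/eqP; rewrite eq_le; apply/andP; split.
    apply: le_trans (umin q sq qu (- x)) _.
    by apply: qC; exists 1; rewrite ?scale1r ?mul1r.
  by rewrite lerNl; have := sublinearN x su; rewrite lerNl.
have uD x y : u (x + y) = u x + u y.
  apply/eqP; rewrite eq_le su.1/= -lerBrDr -uN.
  by rewrite -[in leLHS](addrK y x) su.1.
move=> k x y; rewrite uD; congr (_ + _).
have [k0|k0] := leP 0 k; first exact: sublinearZ.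
rewrite -[k]opprK scaleNr uN sublinearZ// ?oppr_ge0 ?ltW//.
by rewrite scaleNr.
Qed.

(** The subspace is given as the range of T, and the functional on it by its
    pullback phi. Among the sublinear functions below p that are at most phi on
    the range, a minimal one is linear, and a linear function that is at most
    phi agrees with phi. *)
Theorem Hahn_Banach_real (W : lmodType R) (p : V -> R) (T : W -> V)
    (phi : W -> R) :
  sublinear p ->
  (forall x y, T (x + y) = T x + T y) -> (forall k x, T (k *: x) = k *: T x) ->
  linear (phi : W -> R^o) -> (forall w, phi w <= p (T w)) ->
  exists u : V -> R, [/\ linear (u : V -> R^o), forall x, u x <= p x
    & forall w, u (T w) = phi w].
Proof.
move=> sp TD TZ lphi phip.
have phiD x y : phi (x + y) = phi x + phi y.
  by have := lphi 1 x y; rewrite !scale1r.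
have phi0 : phi 0 = 0 by apply: (addrI (phi 0)); rewrite -phiD !addr0.
have phiZ k x : phi (k *: x) = k * phi x.
  by have := lphi k x 0; rewrite !addr0 phi0 addr0.
have T0 : T 0 = 0 by apply: (addrI (T 0)); rewrite -TD !addr0.
have TN x : T (- x) = - T x by rewrite -(scaleN1r x) TZ scaleN1r.
have phiN x : phi (- x) = - phi x by rewrite -scaleN1r phiZ mulN1r.
have [||||q [sq qp qC]] := @sublinear_minorant p
    (fun y a => exists w, y = T w /\ a = phi w) sp.
- by exists 0; rewrite T0 phi0.
- by move=> _ _ _ _ [w [-> ->]] [w' [-> ->]]; exists (w + w').
- by move=> t _ _ _ [w [-> ->]]; exists (t *: w).
- by move=> _ _ [w [-> ->]]; rewrite lerNl -phiN -TN.
have [u [su uq umin]] := minimal_sublinear sq.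
have lu := minimal_sublinear_linear su umin.
have uT w : u (T w) <= phi w by apply: le_trans (uq _) _; apply: qC; exists w.
exists u; split=> // [x|w]; first exact: le_trans (uq _) (qp _).
apply/eqP; rewrite eq_le uT/=.
have uN x : u (- x) = - u x.
  have u0 := sublinear0 su.
  by have := lu (-1) x 0; rewrite !addr0 u0 addr0 !scaleN1r.
by have := uT (- w); rewrite TN uN phiN lerN2.
Qed.

End Sublinear.

(** * Hahn-Banach over both scalar fields, and the canonical embedding *)

Section HahnBanach.
Context (R : realType) (s : scalars).
Local Notation K := (scalar_field R s).

Lemma rotation (z : K) : exists2 k : K, `|k| = 1 & k * z = `|z|.
Proof.
have [->|z0] := eqVneq z 0; first by exists 1; rewrite ?normr1// normr0 mulr0.
exists (`|z| / z); last by rewrite divfK.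
by rewrite normrM normfV normr_id divff ?normr_eq0.
Qed.

(** A complex functional is determined by its real part: f x = u x - i u (i x). *)
Lemma complexification (E : lmodType K) (u : E -> R) :
  linear (u : realify E -> R^o) ->
  exists2 f : E -> K^o, linear f & forall x, toR (f x) = u x.
Proof.
move=> lu.
have uD x y : u (x + y) = u x + u y.
  by have := lu 1 x y; rewrite !scale1r.
have u0 : u 0 = 0 by apply: (addrI (u 0)); rewrite -uD !addr0.
have uZ r x : u (ofR r *: x) = r * u x.
  by have := lu r x 0; rewrite [_ *: _]/(ofR r *: x) !addr0 u0 addr0.
have uN x : u (- x) = - u x.
  by apply/eqP; rewrite -subr_eq0 opprK -uD addNr u0.
rewrite /toR; move: uZ; rewrite /ofR; clear lu.
case: s E u uD u0 uN => E u uD u0 uN uZ.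
  by exists u => // k x y; rewrite uD uZ.
pose i : complex R := 'i%C.
exists (fun x => (u x +i* - u (i *: x))%C) => // -[a b] x y.
have abE : (a +i* b)%C = a%:C%C + i * b%:C%C :> complex R.
  by apply/eqP; rewrite eq_complex /i /= !mul0r !mul1r !subr0 !addr0 !add0r !eqxx.
have uab z : u ((a +i* b)%C *: z) = a * u z + b * u (i *: z).
  by rewrite abE scalerDl uD uZ (mulrC i) -scalerA uZ.
have iE z : i *: ((a +i* b)%C *: z) = (a +i* b)%C *: (i *: z).
  by rewrite !scalerA mulrC.
have iiE z : u (i *: (i *: z)) = - u z.
  rewrite scalerA -uN -scaleN1r; congr (u (_ *: _)).
  by apply/eqP; rewrite eq_complex /i /= !mul0r !mul1r sub0r addr0 oppr0 !eqxx.
rewrite uD uab scalerDr uD iE uab iiE.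
by apply/eqP; rewrite eq_complex /= !mulrN !opprD !opprK !eqxx.
Qed.

(** Rotating x makes f x - g x nonnegative, hence equal to its real part. *)
Lemma linear_eq_toR (W : lmodType K) (f g : W -> K^o) : linear f -> linear g ->
  (forall x, toR (f x) = toR (g x)) -> f = g.
Proof.
move=> lf lg fg; apply/funext => x; apply/eqP; rewrite -subr_eq0 -normr_eq0.
have [k _ kE] := rotation (f x - g x).
have z h : linear h -> h (k *: x) = k * h x :> K.
  move=> lh; have h0 : h 0 = 0 :> K^o.
    by have := lh (-1) 0 0; rewrite scaler0 addr0 scaleN1r addNr.
  by have := lh k x 0; rewrite addr0 h0 addr0.
rewrite -kE mulrBr -(z f)// -(z g)//.
have : toR (f (k *: x) - g (k *: x) : K) = 0 by rewrite toRD toRN fg subrr.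
by rewrite (z f)// (z g)// -mulrBr kE => h; rewrite -[`|_|]toRK// h ofR0.
Qed.

(** The real theorem extends the real part of phi below M * `|x|, and the
    complexification recovers phi. A rotation of x turns `|f x| into a value of
    the real part, so no constant is lost. *)
Theorem Hahn_Banach (E : normedModType K) (W : lmodType K) (T : W -> E)
    (phi : W -> K^o) (M : K) :
  linear T -> linear phi -> 0 <= M -> (forall w, `|phi w| <= M * `|T w|) ->
  exists f : dual E, (forall w, f (T w) = phi w) /\ `|f| <= M.
Proof.
move=> lT lphi M0 phiM.
pose p (x : realify E) := toR (M * `|x : E|).
have pE (x : realify E) : p x = toR M * `|x|.
  by rewrite /p -[in LHS](toRK M0) toR_ofRM.
have sp : sublinear p.
  split=> [x y|t x t0]; rewrite !pE.
    by rewrite -mulrDr ler_wpM2l ?ler_normD// -(@ler_ofR R s) ofR0 toRK.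
  by rewrite normrZ gtr0_norm// mulrCA.
pose phiR (w : realify W) := toR (phi w : K).
have TD (x y : W) : T (x + y) = T x + T y.
  by have := lT 1 x y; rewrite !scale1r.
have T0 : T 0 = 0 by apply: (addrI (T 0)); rewrite -TD !addr0.
have TZ k (x : W) : T (k *: x) = k *: T x.
  by have := lT k x 0; rewrite !addr0 T0 addr0.
have lphiR : linear (phiR : realify W -> R^o).
  move=> k x y; rewrite /phiR.
  rewrite [phi _](lphi (ofR k) x y) toRD; congr (_ + _).
  exact: toR_ofRM.
have phip w : phiR w <= p (T w).
  apply: le_trans (toR_le_norm _) _; apply: ler_toR => //.
have [u [lu up uT]] := @Hahn_Banach_real R (realify E) (realify W) p
  (T : realify W -> realify E) phiR sp TD (fun k => TZ (ofR k)) lphiR phip.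
have [f lf fu] := complexification lu.
have fM x : `|f x| <= M * `|x|.
  have [k k1 kE] := rotation (f x).
  have f0 : f 0 = 0 :> K^o.
    by have := lf (-1) 0 0; rewrite scaler0 addr0 scaleN1r addNr.
  have fk : `|f x| = f (k *: x).
    by have := lf k x 0; rewrite !addr0 f0 addr0 -kE => ->.
  rewrite -[leLHS]toRK// -[leRHS]toRK ?mulr_ge0// ler_ofR fk fu.
  by apply: le_trans (up _) _; rewrite /p normrZ k1 mul1r.
have bf : bounded_linear (f : E -> K^o) by split=> //; exists M.
exists (mk_dual bf); split=> [w|]; last exact: dual_norm_ub.
have := @linear_eq_toR W (fun w => f (T w)) phi.
move=> /(_ _ lphi) h; apply: (congr1 (@^~ w) (h _ _)).
  by move=> k x y; rewrite lT lf.
by move=> x; rewrite fu uT.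
Qed.

Lemma canon_norm (E : normedModType K) (x : E) : `|canon x| = `|x|.
Proof.
apply/eqP; rewrite eq_le; apply/andP; split.
  by apply: dual_norm_ub => // f; rewrite [leRHS]mulrC; exact: (dual_norm_le f x).
have [||||f [fx f1]] := @Hahn_Banach E K^o (fun k => k *: x) (fun k => k * `|x|) 1.
- by move=> k a b; rewrite scalerDl scalerA.
- by move=> k a b; rewrite mulrDl -scalerAl.
- exact: ler01.
- by move=> w; rewrite mul1r normrM normrZ normr_id.
have := fx 1; rewrite scale1r mul1r => fxE.
have := dual_norm_le (canon x) f; rewrite [canon x f]fxE normr_id.
move=> /le_trans; apply.
by rewrite -[leRHS]mulr1 ler_wpM2l.
Qed.

Lemma canon_linear (E : normedModType K) : linear (@canon R s E).
Proof. by move=> k x y; apply: dual_ext => f; exact: dual_linear. Qed.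

Lemma canon0 (E : normedModType K) : canon (0 : E) = 0.
Proof. by apply: dual_ext => f; exact: dual0. Qed.

Lemma canonZ (E : normedModType K) k (x : E) : canon (k *: x) = k *: canon x.
Proof. by apply: dual_ext => f; exact: dualZ. Qed.

Lemma canonB (E : normedModType K) (x y : E) : canon (x - y) = canon x - canon y.
Proof. by rewrite -scaleN1r addrC canon_linear scaleN1r addrC. Qed.

(** E is closed in its bidual, being complete and isometrically embedded. So a
    point F outside E is at a distance e > 0 from it, and k F + x |-> k is a
    functional of norm at most 1 / e that vanishes on E but not at F. *)
Lemma canon_separated (E : completeNormedModType K) (F : dual (dual E)) :
  (forall L : dual (dual (dual E)), (forall x, L (canon x) = 0) -> L F = 0) ->
  exists x, canon x = F.
Proof.
move=> sepF.
have [[e e0 eF]|nF] := pselect (exists2 e : K, 0 < e & forall x, e <= `|F - canon x|).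
  exfalso.
  have [||||L [LF _]] := @Hahn_Banach (dual (dual E)) (K^o * E)%type
     (fun w => w.1 *: F + canon w.2) (fun w => w.1) e^-1.
  - move=> k [a x] [b y] /=.
    by rewrite canon_linear scalerDl scalerDr scalerA addrACA.
  - by move=> k [a x] [b y].
  - by rewrite invr_ge0 ltW.
  - move=> [k x] /=; rewrite mulrC ler_pdivlMr//.
    have [->|k0] := eqVneq k 0; first by rewrite normr0 mul0r.
    have -> : k *: F + canon x = k *: (F - canon (- (k^-1 *: x))).
      rewrite -[- (k^-1 *: x)]sub0r canonB canon0 canonZ sub0r opprK scalerDr.
      by rewrite scalerA divff// scale1r.
    by rewrite normrZ ler_wpM2l.
  have := LF (1, 0); rewrite /= scale1r.
  rewrite canon0 addr0 sepF => [/eqP|x]; first by rewrite eq_sym oner_eq0.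
  by have := LF (0, x); rewrite /= scale0r add0r.
(* Points of E whose images approach F form a Cauchy filter, as the embedding
   is isometric. *)
pose B (e : K) := [set x : E | `|F - canon x| < e].
pose G := filter_from [set e : K | 0 < e] B.
have GP : ProperFilter G.
  apply: filter_from_proper; first apply: filter_from_filter.
  - by exists 1; exact: ltr01.
  - move=> e d /= e0 d0.
    have [ed|de] := real_leP (gtr0_real e0) (gtr0_real d0).
      by exists e => // x Bx; split=> //; exact: lt_le_trans Bx ed.
    by exists d => // x Bx; split=> //; exact: lt_trans Bx de.
  - move=> e /= e0; apply: contrapT => nB; apply: nF; exists e => // x.
    have [//|h] := real_leP (gtr0_real e0) (normr_real (F - canon x)).
    by exfalso; apply: nB; exists x.
have GC : cauchy G.
  have GF : Filter G := @filter_filter _ _ GP.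
  apply/cauchy_ballP => e e0.
  have e2 : 0 < e / 2 by rewrite divr_gt0// ltr0n.
  exists (B (e / 2), B (e / 2)); first by split; exists (e / 2).
  move=> [x y] [/= Bx By]; rewrite -ball_normE /=.
  rewrite -canon_norm.
  have -> : canon (x - y) = (F - canon y) - (F - canon x).
    by rewrite canonB opprB [RHS]addrC addrA subrK.
  apply: le_lt_trans (ler_normB _ _) _.
  by rewrite [ltRHS]splitr ltrD.
have /cvg_ex[x Gx] : cvg G by exact: cauchy_cvg.
exists x; apply/eqP; rewrite eq_sym -subr_eq0 -normr_le0.
apply/ler_addgt0Pr => e e0; rewrite add0r.
have e2 : 0 < e / 2 by rewrite divr_gt0// ltr0n.
have [y [xy Fy]] : exists y, `|x - y| < e / 2 /\ B (e / 2) y.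
  apply: (@filter_ex _ G); apply: filterI; last by exists (e / 2).
  by have := Gx _ (nbhsx_ballx x _ e2); rewrite -ball_normE.
have -> : F - canon x = (F - canon y) - canon (x - y).
  by rewrite canonB opprB addrA subrK.
apply: le_trans (ler_normB _ _) _; rewrite canon_norm [leRHS]splitr.
by rewrite lerD// ltW.
Qed.

End HahnBanach.

(** * Uniform boundedness and surjective adjoints *)

Section UniformBoundedness.
Context (R : realType) (s : scalars).
Local Notation K := (scalar_field R s).

(** Banach-Steinhaus is applied to the real parts on the underlying real space;
    a rotation recovers `|f x|. *)
Theorem uniform_boundedness (E : completeNormedModType K) (S : set (dual E)) :
  (forall x, exists M, forall f, S f -> `|f x| <= M) ->
  exists2 M, 0 <= M & forall f, S f -> `|f| <= M.
Proof.
move=> Sx.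
pose F := [set ((fun x => toR (f x : K)) : realify E -> R^o) | f in S].
have Flin : forall g, F g -> bounded_fun_norm g /\ linear g.
  move=> _ [f Sf <-]; split=> [r|k x y]; last first.
    by rewrite [f _](dual_linear f (ofR k) x y) toRD; congr (_ + _); exact: toR_ofRM.
  exists (toR `|f| * r) => x xr; apply: le_trans (toR_norm_le _) _.
  apply: le_trans (_ : toR `|f| * `|x| <= _); last by rewrite ler_wpM2l// toR_norm_ge0.
  by rewrite -(@ler_ofR R s) ofRM !toRK//; exact: dual_norm_le.
have Fpt : pointwise_bounded F.
  move=> x; have [M MS] := Sx x; exists (toR M) => _ [f Sf <-].
  by apply: le_trans (toR_norm_le _) _; apply: ler_toR => //; exact: MS.
have [M MF] := Banach_Steinhauss Flin Fpt 1.
exists `|ofR M| => // f Sf; apply: dual_norm_ub => // x.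
have [->|x0] := eqVneq x 0; first by rewrite dual0 !normr0 mulr0.
have xgt0 : 0 < `|x| by rewrite normr_gt0.
have [k k1 kE] := rotation (f x).
rewrite -ler_pdivrMr// -kE.
have -> : k * f x / `|x| = f ((k / `|x|) *: x) by rewrite dualZ mulrAC.
have fy0 : 0 <= f ((k / `|x|) *: x).
  by rewrite dualZ; rewrite [_ *: _]mulrAC kE divr_ge0.
rewrite -[leLHS]toRK// ofR_norm ler_ofR.
apply: le_trans (ler_norm _) _; apply: le_trans (_ : _ <= M) (ler_norm _).
apply: (MF (fun x => toR (f x : K))); first by exists f.
rewrite -(@ler_ofR R s) ofR_realify_norm ofR1 normrZ normrM k1 mul1r.
by rewrite normfV normr_id mulVf ?gt_eqF.
Qed.

(** The functionals f with `|adjoint T f| <= 1 are bounded at each point T x,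
    by `|x|, so they are uniformly bounded. *)
Lemma adjoint_bounded_below (E : normedModType K) (F : completeNormedModType K)
    (T : blin E F) : (forall y, exists x, T x = y) ->
  exists2 C, 0 <= C & forall f, `|f| <= C * `|adjoint T f|.
Proof.
move=> Tsurj.
have [|C C0 CP] := @uniform_boundedness F [set f | `|adjoint T f| <= 1].
  move=> y; have [x <-] := Tsurj y; exists `|x| => f /= f1.
  have -> : f (T x) = adjoint T f x by [].
  by apply: le_trans (dual_norm_le _ _) _; rewrite ler_piMl.
exists C => // f.
have [Tf0|Tf0] := eqVneq (adjoint T f) 0.
  have -> : f = 0.
    apply: dual_ext => y; have [x <-] := Tsurj y.
    exact: (congr1 (fun g : dual E => g x) Tf0).
  by rewrite normr0 mulr_ge0.
have Tf : 0 < `|adjoint T f| by rewrite normr_gt0.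
rewrite -ler_pdivrMr// mulrC -[_^-1]ger0_norm ?invr_ge0// -normrZ.
have TZ : adjoint T (`|adjoint T f|^-1 *: f) = `|adjoint T f|^-1 *: adjoint T f.
  exact: dual_ext.
apply: CP; rewrite /mkset TZ.
by rewrite normrZ normfV normr_id mulVf// gt_eqF.
Qed.

(** The functional T x |-> L x is well defined and bounded on the range of T,
    and any extension of it is a preimage of L. *)
Lemma adjoint_surjective (E F : normedModType K) (T : blin E F) (C : K) :
  0 <= C -> (forall x, `|x| <= C * `|T x|) ->
  forall L : dual E, exists f, adjoint T f = L.
Proof.
move=> C0 CT L.
have [||||f [fT _]] := @Hahn_Banach R s F E T L (`|L| * C).
- by case: (blinP T).
- by case: (dualP L).
- exact: mulr_ge0.
- move=> x; apply: le_trans (dual_norm_le _ _) _.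
  by rewrite -mulrA ler_wpM2l.
by exists f; apply: dual_ext.
Qed.

End UniformBoundedness.

(** * Limits along ultrafilters *)

Section Ultrafilters.
Context (R : realType) (s : scalars).
Local Notation K := (scalar_field R s).

Lemma cvg_along_ultrafilters (I : Type) (T : topologicalType) (f : I -> T)
    (F : set_system I) (l : T) : Filter F ->
  (forall U, UltraFilter U -> F `<=` U -> f @ U --> l) -> f @ F --> l.
Proof.
move=> FF FU N Nl; apply: contrapT => nN.
have WP : ProperFilter (within (~` (f @^-1` N)) F).
  split; last exact: within_filter.
  move=> W; apply: nN.
  by apply: (@filterS _ F _ _ _ _ W) => i; exact: contrapT.
have [U [UU WU]] := ultraFilterLemma WP.
have UN : U (f @^-1` N).
  apply: FU => // A FA; apply: WU.
  by apply: filterS FA => i Ai.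
have UnN : U (~` (f @^-1` N)) by apply: WU; exact: withinT.
by have [i [? ?]] := filter_ex (filterI UN UnN).
Qed.

Lemma ultrafilter_cluster (I : Type) (T : topologicalType) (f : I -> T)
    (U : set_system I) (p : T) :
  UltraFilter U -> cluster (f @ U) p -> f @ U --> p.
Proof.
move=> UU fp N Np; have [//|UN] := in_ultra_setVsetC (f @^-1` N) UU.
have UfN : (f @ U) (~` N) by exact: UN.
by have [x []] := fp _ _ UfN Np.
Qed.

(** In the complex case l = - i, and the second real part is the imaginary part of z. *)
Lemma toR_decomposition : exists k l : K, forall z : K,
  z = ofR (toR z) + k * ofR (toR (l * z)).
Proof.
rewrite /ofR /toR; case: s => /=.
  by exists 0, 0 => z; rewrite mul0r addr0.
exists 'i%C, (- 'i%C) => -[a b]; apply/eqP; rewrite eq_complex /=.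
by rewrite oppr0 !mul0r !mul1r !subr0 !addr0 ?mulN1r ?opprK ?add0r ?sub0r ?opprK !eqxx.
Qed.

Lemma ofR_continuous : continuous (ofR : R^o -> K^o).
Proof.
move=> x; apply/cvgrPdist_lt => /= e e0.
have e0' : 0 < toR e by rewrite -(@ltr_ofR R s) ofR0 toRK// ltW.
have := nbhsx_ballx (x : R^o) _ e0'; rewrite -ball_normE.
apply: filterS => y /= xy.
have -> : ofR x - ofR y = ofR (x - y) :> K.
  by apply/eqP; rewrite subr_eq -ofRD subrK.
by rewrite ofR_norm -[e]toRK ?ltr_ofR// ltW.
Qed.

Lemma ultrafilter_bounded_cvg (I : Type) (U : set_system I) (u : I -> K^o) (M : K) :
  UltraFilter U -> (forall i, `|u i| <= M) -> cvg (u @ U).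
Proof.
move=> UU uM.
have cR (v : I -> R^o) (N : R) : (forall i, `|v i| <= N) -> cvg (v @ U).
  move=> vN.
  have vU : U (v @^-1` `[- N, N]%classic).
    by apply: filterS filterT => i _; rewrite /= in_itv /= -ler_norml.
  have [p [_ vp]] := @segment_compact R (- N) N (v @ U) _ vU.
  by apply/cvg_ex; exists p; exact: ultrafilter_cluster.
have [k [l kl]] := toR_decomposition.
have /cvg_ex[a ua] : cvg ((fun i => toR (u i : K) : R^o) @ U).
  apply: (cR _ (toR M)) => i; apply: le_trans (toR_norm_le _) _.
  exact: ler_toR.
have /cvg_ex[b ub] : cvg ((fun i => toR (l * u i : K) : R^o) @ U).
  apply: (cR _ (toR (`|l| * M))) => i; apply: le_trans (toR_norm_le _) _.
  by apply: ler_toR => //; rewrite normrM ler_wpM2l.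
apply/cvg_ex; exists (ofR a + k * ofR b : K^o).
have -> : u = (fun i => ofR (toR (u i : K)) + k * ofR (toR (l * u i : K))).
  by apply/funext => i; exact: kl.
apply: cvgD; last apply: cvgMr.
  exact: (continuous_cvg _ (@ofR_continuous a) ua).
exact: (continuous_cvg _ (@ofR_continuous b) ub).
Qed.

(** Banach-Alaoglu in the form needed for nets: scalar limits along U exist for
    every functional, and they define an element of the bidual. *)
Lemma bounded_ultrafilter_limit (E : normedModType K) (I : Type)
    (U : set_system I) (x : I -> E) (M : K) :
  UltraFilter U -> (forall i, `|x i| <= M) ->
  exists F : dual (dual E), forall f : dual E, (fun i => f (x i)) @ U --> F f.
Proof.
move=> UU xM.
have fxM (f : dual E) i : `|f (x i)| <= M * `|f|.
  by apply: le_trans (dual_norm_le _ _) _; rewrite mulrC ler_wpM2r.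
pose F (f : dual E) := lim ((fun i => f (x i)) @ U).
have FP (f : dual E) : (fun i => f (x i)) @ U --> F f.
  exact: (ultrafilter_bounded_cvg _ (fxM f)).
have bF : bounded_linear F.
  split=> [k f g|].
    have h : (fun i => k *: f (x i) + g (x i)) @ U --> (k *: F f + F g : K^o).
      by apply: cvgD; [apply: cvgZr; exact: FP|exact: FP].
    exact: (@cvg_unique _ (@norm_hausdorff K K^o) _ _ _ _ (FP (k *: f + g)) h).
  exists M => f; apply/ler_addgt0Pr => e e0.
  have [i fi] : exists i, `|F f - f (x i)| < e.
    by apply: (@filter_ex _ U); move/cvgrPdist_lt : (FP f); exact.
  rewrite -[F f](subrK (f (x i))) addrC; apply: le_trans (ler_normD _ _) _.
  by rewrite lerD// ltW.
by exists (mk_dual bF).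
Qed.

End Ultrafilters.

(** * Derivations onto the dual *)

Section Representation.
Context (R : realType) (s : scalars) (A : banachAlgebra R s).
Local Notation K := (scalar_field R s).
Local Notation A' := (dual_bimodule (regular_bimodule A)).

(** Left multiplication by X is weak*-to-weak continuous exactly when each of its
    composites with a functional of the bidual is weak* continuous, that is,
    evaluation at a point of the dual; this form names that point. *)
Definition left_mult_representable : Prop :=
  forall (X : dual (dual A)) (L : dual (dual (dual A))),
    exists g : dual A, forall F, L (arens1 X F) = F g.

(** Writing L = D''G, the derivation identity for the product FG, evaluated at X,
    isolates <L, XF>; what remains are values of F at elements of the dual
    of A. *)
Lemma surjective_derivation_representable (D : blin A A') :
  (forall f : dual A, exists a : A, D a = f) ->
  @is_derivation R s (bidual_algebra A)
    (dual_bimodule (regular_bimodule (bidual_algebra A)))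
    (adjoint (adjoint D)) ->
  left_mult_representable.
Proof.
move=> Dsurj D2 X L.
have [C C0 CP] := adjoint_bounded_below Dsurj.
have [G <-] := @adjoint_surjective R s (dual (dual A)) (dual A) (adjoint D) C C0 CP L.
exists (bidual_lact G (adjoint D X) - adjoint D (arens1 G X)) => F.
have e : F (bidual_lact G (adjoint D X)) =
    G (adjoint D (arens1 X F)) + F (adjoint D (arens1 G X)).
  exact: (congr1 (fun M : dual (dual (dual A)) => M X) (D2 F G)).
have := dual_linear F (-1) (adjoint D (arens1 G X)) (bidual_lact G (adjoint D X)).
rewrite !scaleN1r addrC => ->.
by rewrite e addrC addrK.
Qed.

Context (repr : left_mult_representable).

(** Both Arens products with X on the left are weak* continuous in the second
    factor, and they agree when that factor comes from A. *)
Lemma representable_arens_regular : arens_regular A.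
Proof.
move=> X F; apply: dual_ext => f.
have [g gP] := repr X (canon f).
have -> : arens1 X F f = F g by exact: gP.
congr (F _); apply: dual_ext => a.
have -> : g a = canon a g by [].
rewrite -gP; apply: (congr1 X); exact: dual_ext.
Qed.

Lemma representable_weak_star_weak_continuous (X : dual (dual A)) :
  continuous ((fun F => arens1 X F) :
    weak_star (dual A) -> weak (dual (dual A))).
Proof.
move=> F0.
pose N := nbhs (F0 : weak_star (dual A)).
have NF : Filter N := nbhs_filter (F0 : weak_star (dual A)).
suff : arens1 X @ N --> (arens1 X F0 : weak (dual (dual A))) by [].
apply/weak_cvgP => L; have [g gP] := repr X L.
have LX : (fun F => L (arens1 X F)) = (fun F => F g) by apply/funext.
suff : (fun F => L (arens1 X F)) @ N --> L (arens1 X F0) by [].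
rewrite LX gP; move: g {gP LX}; apply/weak_star_cvgP.
exact: cvg_id.
Qed.

(** If the net f a_i tends weak* to 0 and F is a limit of a_i, then F
    annihilates x f for all x in A, so the second Arens product FX vanishes at f;
    on the other hand <X, f a_i> tends to the value of the first product FX at
    f. Arens regularity identifies the two; the other side is symmetric. *)
Lemma representable_wstarwc : wstarwc (regular_bimodule A).
Proof.
move=> f; split=> I a [M aM] /weak_star_cvgP fa0; apply/weak_cvgP => X.
- apply: (@cvg_along_ultrafilters I _ (fun i => X (ract (f : A') (a i)))
    (tails I)) => U UU IU.
  have [F FP] := bounded_ultrafilter_limit UU aM.
  have FX0 : arens1 F X f = 0.
    rewrite representable_arens_regular.
    apply: etrans (dual0 X); apply: (congr1 X); apply: dual_ext => x.
    apply: (@cvg_unique _ (@norm_hausdorff K K^o) _ _ _ _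
      (FP (lact x (f : A')))).
    exact: cvg_trans (cvg_app _ IU) (fa0 x).
  have -> : X 0 = F (bidual_lact X f) by rewrite dual0 -[LHS]FX0.
  exact: FP.
- apply: (@cvg_along_ultrafilters I _ (fun i => X (lact (a i) (f : A')))
    (tails I)) => U UU IU.
  have [F FP] := bounded_ultrafilter_limit UU aM.
  have XF0 : arens1 X F f = 0.
    apply: etrans (dual0 X); apply: (congr1 X); apply: dual_ext => x.
    apply: (@cvg_unique _ (@norm_hausdorff K K^o) _ _ _ _
      (FP (ract (f : A') x))).
    exact: cvg_trans (cvg_app _ IU) (fa0 x).
  have -> : X 0 = F (bidual_ract f X).
    by rewrite dual0 -[LHS]XF0 representable_arens_regular.
  exact: FP.
Qed.

(** If F is a limit of a_i, then X a_i tends weakly to XF, which is 0 because it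
    is also the weak* limit. *)
Lemma representable_bidual_Lwstarwc : Lwstarwc (dual_bimodule (regular_bimodule A)).
Proof.
move=> X I a [M aM] /weak_star_cvgP Xa0; apply/weak_cvgP => L.
apply: (@cvg_along_ultrafilters I _ (fun i => L (ract X (a i))) (tails I))
  => U UU IU.
have [F FP] := bounded_ultrafilter_limit UU aM.
have Xa i : (ract X (a i) : dual (dual A)) = arens1 X (canon (a i)).
  by apply: dual_ext => f; apply: (congr1 X); exact: dual_ext.
have reprU (N : dual (dual (dual A))) :
    (fun i => N (ract X (a i) : dual (dual A))) @ U --> N (arens1 X F).
  have [g gP] := repr X N; rewrite gP.
  have -> : (fun i => N (ract X (a i) : dual (dual A))) = (fun i => g (a i)).
    by apply/funext => i; rewrite Xa gP.
  exact: FP.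
have XF0 : arens1 X F = 0.
  apply: dual_ext => f.
  apply: (@cvg_unique _ (@norm_hausdorff K K^o) _ _ _ _ (reprU (canon f))).
  exact: cvg_trans (cvg_app _ IU) (Xa0 f).
rewrite -XF0; exact: reprU.
Qed.

(** A left identity E of the bidual makes every L of the third dual an
    evaluation, L F = L (EF) = <F, g>, so L is zero if it vanishes on A. *)
Lemma representable_reflexive :
  has_bounded_left_approximate_identity A -> reflexive_space A.
Proof.
move=> [I [e [[M eM] eid]]] F; apply: canon_separated => L L0.
have [U [UU IU]] := ultraFilterLemma (tails_proper I).
have [E EP] := bounded_ultrafilter_limit UU eM.
(* By Arens regularity this reads <G, fE> = <G, f>, and <E, a f> = f a since
   f (e_i a) tends to f a. *)
have E1 G : arens1 E G = G.
  apply: dual_ext => f; rewrite representable_arens_regular.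
  apply: (congr1 G); apply: dual_ext => a.
  apply: (@cvg_unique _ (@norm_hausdorff K K^o) _ _ _ _ (EP (lact a (f : A')))).
  apply: cvg_trans (cvg_app _ IU) _.
  apply/cvgrPdist_lt => /= d d0.
  have d0' : 0 < d / (`|f| + 1) by rewrite divr_gt0// ltr_wpDl.
  move/cvgrPdist_lt : (eid a) => /(_ _ d0').
  apply: filterS => i; rewrite ltr_pdivlMr ?ltr_wpDl// => h.
  have -> : f a - f (e i ** a) = f (a - e i ** a).
    have := dual_linear f (-1) (e i ** a) a; rewrite !scaleN1r => h'.
    by rewrite addrC -h' addrC.
  apply: le_lt_trans (dual_norm_le _ _) _; apply: le_lt_trans h.
  by rewrite mulrC ler_wpM2l// lerDl.
have [g gP] := repr E L.
have g0 : g = 0.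
  apply: dual_ext => a; have -> : g a = canon a g by [].
  by rewrite -gP E1 L0.
by rewrite -[F]E1 gP g0 dual0.
Qed.

End Representation.

Theorem mainTheorem6 (R : realType) (s : scalars) (A : banachAlgebra R s)
    (D : blin A (dual_bimodule (regular_bimodule A))) :
  is_derivation D ->
  (forall f : dual A, exists a : A, D a = f) ->
  @is_derivation R s (bidual_algebra A)
    (dual_bimodule (regular_bimodule (bidual_algebra A)))
    (adjoint (adjoint D)) ->
  [/\ wstarwc (regular_bimodule A) /\
        Lwstarwc (dual_bimodule (regular_bimodule A)),
      forall F : dual (dual A),
        continuous ((fun G => arens1 F G) :
          weak_star (dual A) -> weak (dual (dual A))),
      arens_regular A
    & has_bounded_left_approximate_identity A -> reflexive_space A].
Proof.
move=> _ Dsurj D2.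
have repr := surjective_derivation_representable Dsurj D2.
split.
- by split; [exact: representable_wstarwc|exact: representable_bidual_Lwstarwc].
- exact: representable_weak_star_weak_continuous.
- exact: representable_arens_regular.
- exact: representable_reflexive.
Qed.
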